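(* Let $\psi:\mathbb{R}^d\to\mathbb{R}\cup\{+\infty\}$ be differentiable everywhere and $\mu$-strongly convex ($\mu>0$) with respect to some norm $\|\cdot\|$ on $\mathbb{R}^d$. Let $x_i\in\mathbb{R}^{d\times k}$ and let $\mathcal{Y}_i\subset\mathbb{R}^k$ be closed convex sets, $i\in\{1,\dots,n\}$. Assume there exists $\theta\in\mathbb{R}^d$ with $\psi(\theta)<\infty$ and $x_i^\top\theta\in\mathcal{Y}_i$ for all $i$. Let $\theta^\star$ be the unique minimizer of $\psi(\theta)$ over all $\theta\in\mathbb{R}^d$ such that $x_i^\top\theta\in\mathcal{Y}_i$ for all $i\in\{1,\dots,n\}$, and assume that the dual objective $G$ (defined in the context) has a maximizer $\alpha^\star\in\mathbb{R}^{n\times k}$. Then for any $\alpha\in\mathbb{R}^{n\times k}$, $$D_\psi(\theta^\star,\theta(\alpha))\leqslant \mathrm{gap}(\alpha).$$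
   Context: Bregman divergence: $D_\psi(\theta,\eta)=\psi(\theta)-\psi(\eta)-\psi'(\eta)^\top(\theta-\eta)$, where $\psi'$ denotes the gradient of $\psi$. Support function: $\sigma_{\mathcal{Y}_i}(\alpha_i)=\sup_{y_i\in\mathcal{Y}_i}y_i^\top\alpha_i$ for $\alpha_i\in\mathbb{R}^k$ (with values in $\mathbb{R}\cup\{+\infty\}$). $\psi^\star$ denotes the Fenchel conjugate of $\psi$. For $\alpha=(\alpha_1,\dots,\alpha_n)\in\mathbb{R}^{n\times k}$ with $\alpha_i\in\mathbb{R}^k$, the dual objective is $$G(\alpha)=-\frac1n\sum_{i=1}^n\sigma_{\mathcal{Y}_i}(\alpha_i)-\psi^\star\Big(-\frac1n\sum_{i=1}^n x_i\alpha_i\Big),$$ which is the Fenchel dual of the problem of minimizing $\psi(\theta)$ subject to $x_i^\top\theta\in\mathcal{Y}_i$ for all $i$. The associated primal point is $\theta(\alpha)=\nabla\psi^\star\big(-\frac1n\sum_{i=1}^n x_i\alpha_i\big)$, and $\mathrm{gap}(\alpha)=G(\alpha^\star)-G(\alpha)\in[0,+\infty]$. *)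

(* Defs.v *)
From HB Require Import structures.
From mathcomp Require Import all_boot all_order all_algebra.
From mathcomp Require Import all_classical all_reals all_analysis.

Set Implicit Arguments.
Unset Strict Implicit.
Unset Printing Implicit Defensive.

Import Order.TTheory GRing.Theory Num.Theory.
Import numFieldNormedType.Exports.

Local Open Scope classical_set_scope.
Local Open Scope ring_scope.

Definition dot (R : realType) (m : nat) (u v : 'cV[R]_m) : R :=
  (u^T *m v) ord0 ord0.

(* An arbitrary norm, unrelated to the sup norm that the library puts on
   'cV[R]_m; nonnegativity follows from these three properties. *)
Definition is_norm (R : realType) (m : nat) (N : 'cV[R]_m -> R) : Prop :=
  [/\ forall u v, N (u + v) <= N u + N v,
      forall (a : R) u, N (a *: u) = `|a| * N u
    & forall u, N u = 0 -> u = 0].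

Definition gradient (R : realType) (m : nat) (f : 'cV[R]_m -> R)
    (u : 'cV[R]_m) : 'cV[R]_m :=
  \col_(j < m) 'D_(delta_mx j ord0) f u.

(* Differentiability of an extended-real function at u: it is finite around u
   and its real-valued part is Frechet differentiable at u. *)
Definition edifferentiable (R : realType) (m : nat) (f : 'cV[R]_m -> \bar R)
    (u : 'cV[R]_m) : Prop :=
  (\forall v \near u, f v \is a fin_num) /\ differentiable (fine \o f) u.

(* Only meaningful where f is finite and differentiable. *)
Definition egradient (R : realType) (m : nat) (f : 'cV[R]_m -> \bar R) :
    'cV[R]_m -> 'cV[R]_m :=
  gradient (fine \o f).

Definition is_argmin (R : realType) (T : Type) (A : set T) (f : T -> \bar R)
    (t : T) : Prop :=
  A t /\ forall s, A s -> (f t <= f s)%E.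

Section ExtendedReal.
Local Open Scope ereal_scope.

Definition strongly_convex (R : realType) (m : nat) (mu : R)
    (N : 'cV[R]_m -> R) (f : 'cV[R]_m -> \bar R) : Prop :=
  forall (u v : 'cV[R]_m) (t : R), (0 <= t <= 1)%R ->
    f (t *: u + (1 - t) *: v)%R <=
    t%:E * f u + (1 - t)%:E * f v
    - (mu / 2 * t * (1 - t) * N (u - v)%R ^+ 2)%:E.

Definition bregman (R : realType) (m : nat) (psi : 'cV[R]_m -> \bar R)
    (theta eta : 'cV[R]_m) : \bar R :=
  psi theta - psi eta - (dot (egradient psi eta) (theta - eta))%:E.

Definition support_function (R : realType) (m : nat) (Y : set 'cV[R]_m)
    (a : 'cV[R]_m) : \bar R :=
  ereal_sup [set (dot y a)%:E | y in Y].

Definition fenchel_conjugate (R : realType) (m : nat)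
    (psi : 'cV[R]_m -> \bar R) (u : 'cV[R]_m) : \bar R :=
  ereal_sup [set (dot u theta)%:E - psi theta | theta in [set: 'cV[R]_m]].

End ExtendedReal.

Definition feasible (R : realType) (n d k : nat) (x : 'I_n -> 'M[R]_(d, k))
    (Y : 'I_n -> set 'cV[R]_k) : set 'cV[R]_d :=
  [set theta | forall i, Y i ((x i)^T *m theta)].

(* alpha in R^{n x k} is stored with alpha_i as its i-th row. *)
Definition block (R : realType) (n k : nat) (alpha : 'M[R]_(n, k)) (i : 'I_n) :
    'cV[R]_k :=
  (row i alpha)^T.

Definition conj_arg (R : realType) (n d k : nat) (x : 'I_n -> 'M[R]_(d, k))
    (alpha : 'M[R]_(n, k)) : 'cV[R]_d :=
  - (n%:R^-1 *: \sum_(i < n) x i *m block alpha i).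

Definition dual_objective (R : realType) (n d k : nat)
    (psi : 'cV[R]_d -> \bar R) (x : 'I_n -> 'M[R]_(d, k))
    (Y : 'I_n -> set 'cV[R]_k) (alpha : 'M[R]_(n, k)) : \bar R :=
  (- (n%:R^-1%:E * \sum_(i < n) support_function (Y i) (block alpha i))
   - fenchel_conjugate psi (conj_arg x alpha))%E.

Definition primal_point (R : realType) (n d k : nat)
    (psi : 'cV[R]_d -> \bar R) (x : 'I_n -> 'M[R]_(d, k))
    (alpha : 'M[R]_(n, k)) : 'cV[R]_d :=
  egradient (fenchel_conjugate psi) (conj_arg x alpha).

Definition gap (R : realType) (n d k : nat)
    (psi : 'cV[R]_d -> \bar R) (x : 'I_n -> 'M[R]_(d, k))
    (Y : 'I_n -> set 'cV[R]_k) (alphastar alpha : 'M[R]_(n, k)) : \bar R :=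
  (dual_objective psi x Y alphastar - dual_objective psi x Y alpha)%E.

(* Main.v *)
Require Import Defs.
From HB Require Import structures.
From mathcomp Require Import all_boot all_order all_algebra.
From mathcomp Require Import all_classical all_reals all_analysis.
From mathcomp Require Import ring lra.

Set Implicit Arguments.
Unset Strict Implicit.
Unset Printing Implicit Defensive.

Import Order.TTheory GRing.Theory Num.Theory.
Import numFieldNormedType.Exports.

Local Open Scope classical_set_scope.
Local Open Scope ring_scope.

(** Write w for [conj_arg x alpha] and f for the real-valued psi. Because f is
differentiable and strongly convex, its gradient is onto, and theta maximizes
<w, .> - f exactly when the gradient of f at theta is w. Hence the conjugate
psi^* is finite everywhere, and its gradient at w is the maximizer theta
([gradient_surj], [gradient_eqP], [egradient_conjugate]). With
eta the maximizer for w, that is eta = theta(alpha), the Bregman divergence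
becomes the Fenchel-Young gap
[[
  D_psi(thetastar, eta) = f(thetastar) + psi^*(w) - <w, thetastar>.
]]
Since thetastar is feasible, each support function at alpha_i is at least
<x_i^T thetastar, alpha_i>. Averaging over i gives
psi^*(w) - <w, thetastar> <= - G(alpha) (weak duality, [dual_objective_le]), so
the divergence is at most f(thetastar) - G(alpha). What remains is that there is
no duality gap: f(thetastar) <= G(alphastar).

This is [strong_duality], read off from the optimality of alphastar. Let theta be
the maximizer defining psi^* at [conj_arg x alphastar]. The smoothness of psi^*
turns optimality into a first-order inequality in every direction
([dual_first_order]). If some x_i^T theta were outside Y_i, moving the i-th
block of alphastar along the normal of a hyperplane separating it from Y_i
([separation]) would violate this inequality; so theta is feasible. Shrinking
alphastar towards 0 bounds the support functions at alphastar from above by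
<x_i^T theta, alphastar_i> on average, that is, G(alphastar) >= f(theta). Finally
f(theta) >= f(thetastar), because theta is feasible.

The existence statements (maximizers for psi^*, projections onto Y_i, and the
comparison of N with the sup norm) all come from minimizing a continuous
function with bounded sublevel sets over a closed set, [coercive_min]. *)

(** * The scalar product on column vectors *)

Section Dot.
Variables (R : realType) (m : nat).
Implicit Types (u v w : 'cV[R]_m) (a : R).

Lemma dotE u v : dot u v = \sum_i u i ord0 * v i ord0.
Proof. by rewrite /dot mxE; apply: eq_bigr => i _; rewrite mxE. Qed.

Lemma dotC u v : dot u v = dot v u.
Proof. by rewrite !dotE; apply: eq_bigr => i _; rewrite mulrC. Qed.

Lemma dotDr u v w : dot u (v + w) = dot u v + dot u w.
Proof. by rewrite /dot mulmxDr mxE. Qed.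

Lemma dotZr a u v : dot u (a *: v) = a * dot u v.
Proof. by rewrite /dot -scalemxAr mxE. Qed.

Lemma dotDl u v w : dot (u + v) w = dot u w + dot v w.
Proof. by rewrite dotC dotDr !(dotC w). Qed.

Lemma dotZl a u v : dot (a *: u) v = a * dot u v.
Proof. by rewrite dotC dotZr dotC. Qed.

Lemma dotNr u v : dot u (- v) = - dot u v.
Proof. by rewrite -scaleN1r dotZr mulN1r. Qed.

Lemma dotNl u v : dot (- u) v = - dot u v.
Proof. by rewrite dotC dotNr dotC. Qed.

Lemma dot0r u : dot u 0 = 0.
Proof. by rewrite -(scale0r 0) dotZr mul0r. Qed.

Lemma dot0l u : dot 0 u = 0.
Proof. by rewrite dotC dot0r. Qed.

Lemma dotvv_ge0 u : 0 <= dot u u.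
Proof. by rewrite dotE sumr_ge0// => i _; rewrite -expr2 sqr_ge0. Qed.

Lemma dotvv_eq0 u : dot u u = 0 -> u = 0.
Proof.
rewrite dotE => /eqP; rewrite psumr_eq0 => [/allP u0|i _]; last first.
  by rewrite -expr2 sqr_ge0.
apply/matrixP => i j; rewrite ord1 mxE; apply/eqP.
by have /implyP/(_ isT) := u0 i (mem_index_enum i); rewrite mulf_eq0 orbb.
Qed.

Lemma dot_delta u i : dot u (delta_mx i ord0) = u i ord0.
Proof.
rewrite dotE (bigD1 i)//= mxE !eqxx mulr1 big1 ?addr0// => j ji.
by rewrite mxE (negbTE ji) mulr0.
Qed.

Lemma dotvvD u v t :
  dot (u + t *: v) (u + t *: v) =
  dot u u + (t * (2 * dot u v) + t ^+ 2 * dot v v).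
Proof. by rewrite dotDl !dotDr !dotZl !dotZr (dotC v u); ring. Qed.

End Dot.

Lemma dot_mul (R : realType) (p q : nat) (A : 'M[R]_(p, q)) u v :
  dot (A *m u) v = dot u (A^T *m v).
Proof. by rewrite /dot trmx_mul mulmxA. Qed.

Lemma dot_sumr (R : realType) (m : nat) (I : Type) (r : seq I)
    (F : I -> 'cV[R]_m) u :
  dot u (\sum_(i <- r) F i) = \sum_(i <- r) dot u (F i).
Proof. by rewrite /dot mulmx_sumr summxE. Qed.

(** * Topology of the space of column vectors *)

Lemma lipschitz_continuous (R : realType) (V W : normedModType R) (f : V -> W)
    (C : R) : (forall u v, `|f u - f v| <= C * `|u - v|) -> continuous f.
Proof.
move=> fC u; apply/cvgrPdist_lt => e e0.
have C0 : 0 < `|C| + 1 by rewrite ltr_wpDl.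
near=> v; apply: (@le_lt_trans _ _ ((`|C| + 1) * `|u - v|)).
  apply: le_trans (fC u v) _; rewrite ler_wpM2r//.
  by rewrite (le_trans (ler_norm C))// lerDl.
rewrite mulrC -ltr_pdivlMr//.
by near: v; apply: cvgr_dist_lt => //; rewrite divr_gt0.
Unshelve. all: by end_near. Qed.

Section FiniteDimension.
Variables (R : realType) (m : nat).
Implicit Types (u v w : 'cV[R]_m).

Lemma ler_coord_norm u i : `|u i ord0| <= `|u|.
Proof.
rewrite -[leRHS]/(mx_norm _) mx_normrE; apply/bigmax_geP; right.
by exists (i, ord0).
Qed.

Lemma norm_trmx p q (A : 'M[R]_(p, q)) : `|A^T| <= `|A|.
Proof.
rewrite -[leLHS]/(mx_norm _) mx_normrE; apply/bigmax_leP; split=> //=.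
move=> -[i j] _ /=.
rewrite mxE -[leRHS]/(mx_norm A) mx_normrE; apply/bigmax_geP; right.
by exists (j, i).
Qed.

Lemma continuous_trmx p q : continuous (trmx : 'M[R]_(p, q) -> 'M[R]_(q, p)).
Proof.
apply: (@lipschitz_continuous _ _ _ _ 1) => A B.
by rewrite mul1r -linearB/= norm_trmx.
Qed.

Lemma dot_le_norm v u : `|dot v u| <= (\sum_i `|v i ord0|) * `|u|.
Proof.
rewrite dotE mulr_suml (le_trans (ler_norm_sum _ _ _))//.
by apply: ler_sum => i _; rewrite normrM ler_wpM2l// ler_coord_norm.
Qed.

Lemma continuous_dot v : continuous (dot v).
Proof.
apply: (@lipschitz_continuous _ _ _ _ (\sum_i `|v i ord0|)) => u w.
by rewrite -dotNr -dotDr dot_le_norm.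
Qed.

Lemma sqr_norm_le_dot u : `|u| ^+ 2 <= dot u u.
Proof.
rewrite -[`|u|]/(mx_norm u); have [->|] := eqVneq (mx_norm u) 0.
  by rewrite expr0n dotvv_ge0.
move=> /mx_norm_neq0[[i j] ->] /=; rewrite (ord1 j) real_normK ?num_real//.
rewrite dotE (bigD1 i)//= expr2 lerDl sumr_ge0// => l _.
by rewrite -expr2 sqr_ge0.
Qed.

Lemma continuous_dotvv : continuous (fun u : 'cV[R]_m => dot u u).
Proof.
have -> : (fun u : 'cV[R]_m => dot u u) =
    fun u => \sum_i dot (delta_mx i ord0) u * dot (delta_mx i ord0) u.
  apply/funext => u; rewrite dotE; apply: eq_bigr => i _.
  by rewrite dotC dot_delta.
have cD : continuous (fun z : R * R => z.1 + z.2) by exact: add_continuous.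
have cF i : continuous (fun u : 'cV[R]_m =>
    dot (delta_mx i ord0) u * dot (delta_mx i ord0) u).
  by move=> u; apply: continuousM; exact: continuous_dot.
exact: (@continuous_big R _ +%R 0 predT cD 'cV[R]_m (index_enum 'I_m) _
  (fun i _ => cF i)).
Qed.

(** Transposition is an isometry, so this reduces to row vectors. *)
Lemma bounded_closed_compact_cV (A : set 'cV[R]_m) B :
  (forall u, A u -> `|u| <= B) -> closed A -> compact A.
Proof.
move=> AB cA.
have -> : A = trmx @` (trmx @^-1` A : set 'rV[R]_m).
  apply/seteqP; split=> [u Au|_ [v Av <-]//].
  by exists u^T; rewrite /= trmxK.
apply: continuous_compact; first exact/continuous_subspaceT/continuous_trmx.
apply: bounded_closed_compact; last first.
  by apply: closed_comp => // u _; exact: continuous_trmx.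
exists B; split; first exact: num_real.
move=> C BC u /AB uB; apply: le_trans (ltW BC); apply: le_trans uB.
by rewrite -{1}[u]trmxK; exact: norm_trmx.
Qed.

(** Only the part of [A] where [f] is at most [f a] matters for the minimum; it
is compact, so the extreme value theorem applies to it. *)
Lemma coercive_min (f : 'cV[R]_m -> R) (A : set 'cV[R]_m) a B :
  continuous f -> closed A -> A a ->
  (forall u, A u -> f u <= f a -> `|u| <= B) ->
  exists2 c, A c & forall u, A u -> f c <= f u.
Proof.
move=> cf cA Aa fB.
pose L := A `&` [set u | f u <= f a].
have [|||c /set_mem[Ac fca] cmin] := @compact_EVT_min _ R f L.
- by exists a; split=> /=.
- apply: (@bounded_closed_compact_cV _ B) => [u [Au]|]; first exact: fB.
  apply: closedI => //; apply: (@closed_comp _ _ f [set x | x <= f a]).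
    by move=> u _; exact: cf.
  exact: closed_le.
- exact/continuous_subspaceT.
exists c => // u Au; have [ua|/ltW au] := leP (f u) (f a).
  by apply: cmin; rewrite inE.
exact: le_trans au.
Qed.

(** One half of the equivalence of norms in finite dimension: [N] is Lipschitz
for the sup norm, hence attains a minimum on the sup-norm unit sphere, and this
minimum is positive because [N] vanishes only at 0. *)
Lemma norm_equiv (N : 'cV[R]_m -> R) : is_norm N ->
  exists2 c, 0 < c & forall u, c * `|u| <= N u.
Proof.
move=> [Ntri NZ N0].
have N00 : N 0 = 0 by rewrite -(scale0r 0) NZ normr0 mul0r.
have NN u : N (- u) = N u by rewrite -scaleN1r NZ normrN normr1 mul1r.
have Nge0 u : 0 <= N u.
  by have := Ntri u (- u); rewrite NN subrr N00; lra.
pose C := \sum_i N (delta_mx i ord0).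
have NC u : N u <= C * `|u|.
  rewrite [in N u](matrix_sum_delta u) mulr_suml.
  have Nsum (F : 'I_m -> 'cV[R]_m) : N (\sum_i F i) <= \sum_i N (F i).
    elim/big_ind2 : _ => [|x1 x2 y1 y2 h1 h2|//]; first by rewrite N00.
    by rewrite (le_trans (Ntri _ _))// lerD.
  apply: le_trans (Nsum _) _; apply: ler_sum => i _.
  by rewrite big_ord1 NZ mulrC ler_wpM2l// ler_coord_norm.
have cN : continuous N.
  apply: (@lipschitz_continuous _ _ _ _ C) => u v.
  have := NC (u - v).
  have := Ntri (u - v) v; rewrite subrK.
  have := Ntri (v - u) u; rewrite subrK -opprB NN.
  by rewrite ler_norml; lra.
(* In dimension 0 the unit sphere is empty and there is nothing to minimize. *)
have [[u0 u00]|noz] := pselect (exists u : 'cV[R]_m, u != 0); last first.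
  exists 1 => // u; have [->|un0] := eqVneq u 0; first by rewrite normr0 mulr0.
  by exfalso; apply: noz; exists u.
have normed u : u != 0 -> `|(`|u|^-1 *: u)| = 1.
  by move=> un0; rewrite normrZ normfV normr_id mulVf// normr_eq0.
have [||||c c1 cmin] :=
    @coercive_min N [set u | `|u| = 1] (`|u0|^-1 *: u0) 1.
- exact: cN.
- apply: (@closed_comp _ _ _ [set x : R | x = 1]); last exact: closed_eq.
  by move=> u _; exact: norm_continuous.
- exact: normed.
- by move=> u /= ->.
exists (N c).
  rewrite lt_neqAle Nge0 andbT eq_sym; apply/negP => /eqP /N0 c0.
  by move: c1; rewrite /= c0 normr0 => /eqP; rewrite eq_sym oner_eq0.
move=> u; have [->|un0] := eqVneq u 0; first by rewrite normr0 mulr0 N00.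
have /= := cmin _ (normed _ un0).
rewrite NZ normfV normr_id => h.
by rewrite mulrC -ler_pdivlMl ?normr_gt0.
Qed.

Lemma dot_bounded (N : 'cV[R]_m -> R) : is_norm N ->
  forall v, exists2 C, 0 <= C & forall u, `|dot v u| <= C * N u.
Proof.
move=> /norm_equiv[c c0 cN] v.
have S0 : 0 <= \sum_i `|v i ord0| by apply: sumr_ge0.
exists ((\sum_i `|v i ord0|) / c); first by rewrite divr_ge0// ltW.
move=> u; apply: (@le_trans _ _ ((\sum_i `|v i ord0|) * `|u|)).
  exact: dot_le_norm.
by rewrite -mulrA ler_wpM2l// ler_pdivlMl.
Qed.

End FiniteDimension.

(** * Directional derivatives and first-order inequalities *)

Section Derivative.
Variables (R : realType) (m : nat).
Implicit Types (u v w : 'cV[R]_m).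

(** The gradient is made of partial derivatives; that it controls the derivative
in every direction comes from the linearity of the differential. *)
Lemma dot_gradient (f : 'cV[R]_m -> R) u v :
  differentiable f u -> dot (gradient f u) v = 'D_v f u.
Proof.
move=> df; rewrite deriveE// {2}(matrix_sum_delta v) linear_sum/= dotE.
apply: eq_bigr => i _; rewrite big_ord1 linearZ/= mxE deriveE//.
by rewrite mulrC.
Qed.

(** The slack [t * C] is what the modulus of strong convexity contributes to the
difference quotient; it disappears in the limit. *)
Lemma derive_le (f : 'cV[R]_m -> R) u v K C :
  differentiable f u ->
  (forall t, 0 < t < 1 -> f (t *: v + u) - f u <= t * (K + t * C)) ->
  'D_v f u <= K.
Proof.
move=> df fK.
have /cvg_dnbhs_at_right qD :
    (fun h => h^-1 *: ((f \o shift u) (h *: v) - f u)) @ 0^' --> 'D_v f u.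
  exact: diff_derivable.
have KK : (fun h : R => K + h * C) @ 0^'+ --> K.
  rewrite -[X in _ --> X]addr0 -[X in _ --> _ + X](mul0r C).
  apply: cvgD; first exact: cvg_cst.
  by apply: cvgMl; apply: cvg_at_right_filter; exact: cvg_id.
apply: (ler_cvg_to qD KK).
near=> h; have h0 : 0 < h by near: h; exact: nbhs_right_gt.
change (h^-1 * (f (h *: v + u) - f u) <= K + h * C).
rewrite ler_pdivrMl//; apply: fK; rewrite h0/=.
by near: h; exact: nbhs_right_lt.
Unshelve. all: by end_near. Qed.

Lemma derive_ge (f : 'cV[R]_m -> R) u v K :
  differentiable f u ->
  (forall t, 0 < t < 1 -> t * K <= f (t *: v + u) - f u) -> K <= 'D_v f u.
Proof.
move=> df fK; rewrite -lerN2 -deriveN; last exact: diff_derivable.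
apply: (@derive_le _ _ _ _ 0); first exact: differentiableN.
move=> t /fK; rewrite -[(- f) _]/(- f _) -[(- f) u]/(- f u); lra.
Qed.

(** Two-sided quadratic control of the increments is the form in which the
smoothness of a conjugate function is obtained. *)
Lemma derive_quadratic (f : 'cV[R]_m -> R) u v K C :
  (forall t, `|f (t *: v + u) - f u - t * K| <= t ^+ 2 * C) ->
  'D_v f u = K.
Proof.
move=> fK; apply: cvg_lim => //.
have C0 : 0 <= C.
  by have := fK 1; rewrite expr1n !mul1r; exact: le_trans.
apply/cvgrPdist_lt => e e0; near=> t.
change (`|K - t^-1 * (f (t *: v + u) - f u)| < e).
have t0 : 0 < `|t| by rewrite normr_gt0; near: t; exact: nbhs_dnbhs_neq.
have te : `|t| * (C + 1) < e.
  rewrite -ltr_pdivlMr; last by lra.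
  by near: t; apply: dnbhs0_lt; rewrite divr_gt0//; lra.
have -> : K - t^-1 * (f (t *: v + u) - f u) =
    - (t^-1 * (f (t *: v + u) - f u - t * K)).
  by field; rewrite -normr_gt0.
rewrite normrN normrM normfV ltr_pdivrMl//; apply: le_lt_trans (fK t) _.
rewrite -(real_normK (num_real t)) expr2 -mulrA ltr_pM2l//; lra.
Unshelve. all: by end_near. Qed.

End Derivative.

(** The second-order term is negligible for small [t]: the first-order
optimality conditions below are deduced from this. *)
Lemma ge0_first_order (R : realType) (A C : R) :
  (forall t, 0 < t < 1 -> 0 <= t * A + t ^+ 2 * C) -> 0 <= A.
Proof.
move=> AC; rewrite leNgt; apply/negP => A0.
(* At t = - A / d the quadratic term is smaller than - t * A, and t < 1. *)
pose d := 2 * (`|C| - A + 1).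
have C0 := normr_ge0 C; have CC := ler_norm C.
have d0 : 0 < d by rewrite /d; lra.
have t0 : 0 < - A / d by rewrite divr_gt0// oppr_gt0.
have t1 : - A / d < 1 by rewrite ltr_pdivrMr// /d; lra.
have := AC (- A / d); rewrite t0 t1 => /(_ isT).
rewrite expr2 -mulrA -mulrDr pmulr_rge0// leNgt => /negP; apply.
have : - A / d * C <= - A / d * `|C| by rewrite ler_wpM2l// ltW.
have : - A / d * `|C| < - A.
  by rewrite mulrAC ltr_pdivrMr// ltr_pM2l ?oppr_gt0// /d; lra.
lra.
Qed.

(** * Conjugates of differentiable strongly convex functions *)

Section StrongConvexity.
Variables (R : realType) (m : nat) (f : 'cV[R]_m -> R).
Hypothesis f_diff : forall u, differentiable f u.
Variables (N : 'cV[R]_m -> R) (mu : R).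
Hypotheses (hN : is_norm N) (mu_gt0 : 0 < mu).
Hypothesis f_sc : strongly_convex mu N (EFin \o f).

(** Strong convexity bounds the difference quotient of [f] at [v] in direction
[u - v]; the inequality is its limit as the step goes to 0. *)
Lemma first_order_lower_bound u v :
  f v + dot (gradient f v) (u - v) + mu / 2 * N (u - v) ^+ 2 <= f u.
Proof.
suff : 'D_(u - v) f v <= f u - f v - mu / 2 * N (u - v) ^+ 2.
  by rewrite dot_gradient//; lra.
apply: (@derive_le _ _ _ _ _ _ (mu / 2 * N (u - v) ^+ 2)) => // t /andP[t0 t1].
have t01 : 0 <= t <= 1 by rewrite !ltW.
have := f_sc u v t01; rewrite /= -!EFinM -!EFinD lee_fin.
have -> : t *: u + (1 - t) *: v = t *: (u - v) + v.
  by rewrite scalerBl scalerBr scale1r -addrA [- _ + v]addrC addrA.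
lra.
Qed.

(** By convexity a critical point of f - <w, .> is a global minimizer; the
converse is Fermat's rule. *)
Lemma gradient_eqP w theta : gradient f theta = w <->
  forall u, dot w u - f u <= dot w theta - f theta.
Proof.
split=> [<- u|maxw].
  have := first_order_lower_bound u theta; rewrite dotDr dotNr.
  have : 0 <= mu / 2 * N (u - theta) ^+ 2.
    by rewrite mulr_ge0 ?sqr_ge0 ?divr_ge0 ?ltW.
  lra.
suff gw v : dot w v <= dot (gradient f theta) v.
  apply/esym/eqP; rewrite -subr_eq0; apply/eqP/dotvv_eq0/le_anti.
  by rewrite dotvv_ge0 andbT dotDl dotNl subr_le0 gw.
rewrite dot_gradient//; apply: derive_ge => // t _.
by have := maxw (t *: v + theta); rewrite dotDr dotZr; lra.
Qed.

(** Strong convexity makes f - <w, .> coercive: its first-order lower bound at 0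
grows quadratically in [N]. Its minimizer is critical. *)
Lemma gradient_surj w : exists theta, gradient f theta = w.
Proof.
have [c c0 cN] := norm_equiv hN.
have [C C0 CN] := dot_bounded hN (w - gradient f 0).
have cf : continuous f by move=> u; exact: differentiable_continuous.
have cg : continuous (f \- dot w).
  by move=> u; apply: continuousB; [exact: cf | exact: continuous_dot].
have [||//||theta _ min_theta] := @coercive_min _ _ (f \- dot w) setT 0
    (2 * C / mu / c).
- exact: cg.
- exact: closedT.
- move=> u _ /=; rewrite dot0r subr0 => fu.
  have := first_order_lower_bound u 0; rewrite subr0 => lb.
  have := ler_norm (dot (w - gradient f 0) u); rewrite dotDl dotNl => du.
  have := CN u; rewrite dotDl dotNl => CNu.
  have N0 : 0 <= N u by rewrite (le_trans _ (cN u))// mulr_ge0// ltW.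
  have NC : N u <= 2 * C / mu.
    rewrite ler_pdivlMr//; have [->|Nn0] := eqVneq (N u) 0.
      by rewrite mul0r mulr_ge0.
    by rewrite -(@ler_pM2l _ (N u)) ?lt0r ?Nn0//; lra.
  by rewrite ler_pdivlMr// mulrC (le_trans (cN u)).
exists theta; apply/gradient_eqP => u.
by have /= := min_theta u Logic.I; lra.
Qed.

(** By [fin_fenchel_conjugate] the conjugate is finite everywhere, so that [fine]
loses nothing. *)
Definition real_conjugate w := fine (fenchel_conjugate (EFin \o f) w).

Lemma fenchel_conjugateE w theta : gradient f theta = w ->
  fenchel_conjugate (EFin \o f) w = (dot w theta - f theta)%:E.
Proof.
move=> /gradient_eqP maxw; apply/eqP; rewrite eq_le; apply/andP; split.
  by apply: ge_ereal_sup => _ [u _ <-] /=; rewrite -EFinB lee_fin.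
by apply: ereal_sup_ubound; exists theta => //=; rewrite EFinB.
Qed.

Lemma real_conjugateE w theta : gradient f theta = w ->
  real_conjugate w = dot w theta - f theta.
Proof. by rewrite /real_conjugate => /fenchel_conjugateE ->. Qed.

Lemma fin_fenchel_conjugate w :
  fenchel_conjugate (EFin \o f) w = (real_conjugate w)%:E.
Proof.
have [theta /fenchel_conjugateE h] := gradient_surj w.
by rewrite /real_conjugate h.
Qed.

(** Duality between strong convexity and smoothness. The lower bound tests the
supremum at the old maximizer [theta]. For the upper bound, the new maximizer
can gain at most [t * dot v _] on its displacement, while strong convexity
charges at least [mu / 2] times the square of that displacement. *)
Lemma real_conjugate_smooth w theta v : gradient f theta = w ->
  exists C, forall t,
    0 <= real_conjugate (t *: v + w) - real_conjugate w - t * dot v theta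
      <= t ^+ 2 * C.
Proof.
move=> gw; have [C C0 CN] := dot_bounded hN v.
exists (C ^+ 2 / (2 * mu)) => t.
have [eta geta] := gradient_surj (t *: v + w).
rewrite (real_conjugateE gw) (real_conjugateE geta) !dotDl !dotZl.
apply/andP; split.
  have /gradient_eqP/(_ theta) := geta; rewrite !dotDl !dotZl; lra.
have := first_order_lower_bound eta theta; rewrite gw dotDr dotNr.
have := CN (eta - theta); rewrite dotDr dotNr.
set n := N _; set z := dot v eta - dot v theta => zn lb.
suff : t * z - mu / 2 * n ^+ 2 <= t ^+ 2 * (C ^+ 2 / (2 * mu)).
  by rewrite /z; lra.
have tz : t * z <= `|t| * (C * n).
  by rewrite (le_trans (ler_norm _))// normrM ler_wpM2l.
(* Complete the square: |t| * C * n - mu / 2 * n ^+ 2 peaks at |t| * C / mu. *)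
have : 0 <= (`|t| * C - mu * n) ^+ 2 / (2 * mu).
  by rewrite divr_ge0 ?sqr_ge0// mulr_ge0// ltW.
have -> : (`|t| * C - mu * n) ^+ 2 / (2 * mu) =
    `|t| ^+ 2 * (C ^+ 2 / (2 * mu)) - `|t| * (C * n) + mu / 2 * n ^+ 2.
  by field; rewrite gt_eqF.
by rewrite real_normK ?num_real//; lra.
Qed.

Lemma egradient_conjugate w theta : gradient f theta = w ->
  egradient (fenchel_conjugate (EFin \o f)) w = theta.
Proof.
move=> gw; apply/matrixP => i j; rewrite ord1 /egradient mxE.
have [C smooth] := real_conjugate_smooth (delta_mx i ord0) gw.
rewrite -(dot_delta theta) dotC; apply: (@derive_quadratic _ _ _ _ _ _ C) => t.
by have /andP[h1 h2] := smooth t; rewrite ger0_norm.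
Qed.

End StrongConvexity.

(** * Separation of a point from a closed convex set *)

(** The normal is [z - p], where [p] is the projection of [z] onto [Y]; that it
separates is the variational inequality of the projection, i.e. the first-order
condition for minimizing the squared distance along the segments from [p]. *)
Lemma separation (R : realType) (m : nat) (Y : set 'cV[R]_m) (z : 'cV[R]_m) :
  closed Y -> convex_set Y -> Y !=set0 -> ~ Y z ->
  exists a c, (forall y, Y y -> dot y a <= c) /\ c < dot z a.
Proof.
move=> cY vY [y0 Yy0] nYz.
pose q y := dot (y - z) (y - z).
have qD p y t : q (t *: y + (1 - t) *: p) =
    q p + (t * (2 * dot (p - z) (y - p)) + t ^+ 2 * dot (y - p) (y - p)).
  rewrite /q -dotvvD; congr dot; apply/matrixP => i j; rewrite !mxE; ring.
have cq : continuous q.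
  have -> : q = (fun y => dot y y) \+ (dot (- 2 *: z) \+ cst (dot z z)).
    apply/funext => y; rewrite /q -scaleN1r dotvvD/= dotZl (dotC z); ring.
  move=> y; apply: continuousD; first exact: continuous_dotvv.
  by apply: continuousD; [exact: continuous_dot | exact: cst_continuous].
have [||||p Yp min_p] := @coercive_min _ _ q Y y0 (`|z| + (1 + q y0)).
- exact: cq.
- exact: cY.
- exact: Yy0.
- move=> u _ qu; rewrite -[u in `|u|](subrK z) addrC.
  apply: le_trans (ler_normD _ _) _; rewrite lerD2l.
  have := sqr_norm_le_dot (u - z); rewrite -/(q u).
  have := normr_ge0 (u - z); nra.
exists (z - p), (dot p (z - p)); split; last first.
  rewrite -subr_gt0 -dotNl -dotDl lt0r dotvv_ge0 andbT.
  apply/negP => /eqP/dotvv_eq0/eqP; rewrite subr_eq0 => /eqP zp.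
  by apply: nYz; rewrite zp.
move=> y Yy; rewrite -subr_ge0 -dotNl -dotDl -opprB -(opprB p z).
rewrite dotNl dotNr opprK dotC.
suff : 0 <= 2 * dot (p - z) (y - p) by lra.
apply: (@ge0_first_order _ _ (dot (y - p) (y - p))) => t /andP[t0 t1].
have /set_mem : t *: y + (1 - t) *: p \in Y.
  have := vY y p (Itv01 (ltW t0) (ltW t1)); rewrite !inE; exact.
by move=> /min_p; rewrite qD lerDl.
Qed.

(** * The dual objective *)

Section Duality.
Variables (R : realType) (n d k : nat).
Hypothesis hn : (0 < n)%N.
Variables (x : 'I_n -> 'M[R]_(d, k)) (Y : 'I_n -> set 'cV[R]_k).
Implicit Types (A B : 'M[R]_(n, k)) (theta : 'cV[R]_d).

Lemma blockD_scale A B t i :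
  block (A + t *: B) i = block A i + t *: block B i.
Proof. by apply/matrixP => a b; rewrite !mxE. Qed.

Lemma conj_argD_scale A B t :
  conj_arg x (A + t *: B) = t *: conj_arg x B + conj_arg x A.
Proof.
rewrite /conj_arg scalerN scalerA mulrC -scalerA -opprD -scalerDr.
congr (- (_ *: _)); rewrite scaler_sumr -big_split/=; apply: eq_bigr => i _.
by rewrite blockD_scale mulmxDr -scalemxAr addrC.
Qed.

Lemma dot_conj_arg A theta : dot (conj_arg x A) theta =
  - (n%:R^-1 * \sum_i dot (block A i) ((x i)^T *m theta)).
Proof.
rewrite /conj_arg dotNl dotZl dotC dot_sumr; congr (- (_ * _)).
by apply: eq_bigr => i _; rewrite dotC dot_mul.
Qed.

Section Objective.
Variable psi : 'cV[R]_d -> \bar R.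
Variable phi : 'cV[R]_d -> R.
Hypothesis phiE : forall w, fenchel_conjugate psi w = (phi w)%:E.

Lemma dual_objective_ge A (s : 'I_n -> R) :
  (forall i y, Y i y -> dot y (block A i) <= s i) ->
  ((- (n%:R^-1 * \sum_i s i) - phi (conj_arg x A))%:E
    <= dual_objective psi x Y A)%E.
Proof.
move=> ys; rewrite /dual_objective phiE EFinB EFinN leeB//.
rewrite leeN2 EFinM lee_wpmul2l ?lee_fin ?invr_ge0//.
rewrite -sumEFin; apply: lee_sum => i _.
by apply: ge_ereal_sup => _ [y Yy <-]; rewrite lee_fin ys.
Qed.

(** Weak duality, with the points [y i] standing for the constraint values of a
feasible point. *)
Lemma dual_objective_le A (y : 'I_n -> 'cV[R]_k) : (forall i, Y i (y i)) ->
  (dual_objective psi x Y A <=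
    (- (n%:R^-1 * \sum_i dot (y i) (block A i)) - phi (conj_arg x A))%:E)%E.
Proof.
move=> Yy; rewrite /dual_objective phiE EFinB EFinN leeB//.
rewrite leeN2 EFinM lee_wpmul2l ?lee_fin ?invr_ge0//.
rewrite -sumEFin; apply: lee_sum => i _.
by apply: ereal_sup_ubound; exists (y i).
Qed.

(** An infinite support function would make the objective -oo, so where the
objective is larger than -oo the support functions have real values [s]. *)
Lemma dual_objectiveE A (y : 'I_n -> 'cV[R]_k) : (forall i, Y i (y i)) ->
  (-oo < dual_objective psi x Y A)%E ->
  exists s : 'I_n -> R,
    (forall i y, Y i y -> dot y (block A i) <= s i) /\
    dual_objective psi x Y A =
      (- (n%:R^-1 * \sum_i s i) - phi (conj_arg x A))%:E.
Proof.
move=> Yy Gfin; pose S i := support_function (Y i) (block A i).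
have SgtNy i : (-oo < S i)%E.
  apply: lt_le_trans (ltNyr (dot (y i) (block A i))) _.
  by apply: ereal_sup_ubound; exists (y i).
have SltNy i : (S i < +oo)%E.
  rewrite ltey; apply/negP => /eqP Siy.
  have Sy : (\sum_(j < n) S j = +oo)%E.
    apply/esum_eqyP => [j _|]; last by exists i; rewrite mem_index_enum.
    by rewrite -ltNye.
  move: Gfin; rewrite /dual_objective phiE -/(S _) Sy.
  by rewrite gt0_muley ?lte_fin ?invr_gt0 ?ltr0n.
have SE i : S i = (fine (S i))%:E.
  by rewrite fineK// fin_numElt SgtNy SltNy.
exists (fine \o S); split=> [i z Yz|].
  by rewrite -lee_fin -SE; apply: ereal_sup_ubound; exists z.
rewrite /dual_objective phiE EFinB EFinN EFinM -sumEFin.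
by congr (- (_ * _) - _)%E; apply: eq_bigr => i _; exact: SE.
Qed.

End Objective.

Section StrongDuality.
Variable f : 'cV[R]_d -> R.
Hypothesis f_diff : forall u, differentiable f u.
Variables (N : 'cV[R]_d -> R) (mu : R).
Hypotheses (hN : is_norm N) (mu_gt0 : 0 < mu).
Hypothesis f_sc : strongly_convex mu N (EFin \o f).
Local Notation psi := (EFin \o f).
Local Notation G := (dual_objective psi x Y).

Let phiE := fin_fenchel_conjugate f_diff hN mu_gt0 f_sc.

(** In the direction [B] the conjugate decreases at first order by the average of
the numbers [dot (block B i) ((x i)^T *m theta)]. If the average of the growth
rates [c] of the support functions were smaller, the objective would increase,
against the optimality of [A]. *)
Lemma dual_first_order A B (s c : 'I_n -> R) theta :
  G A = (- (n%:R^-1 * \sum_i s i) - real_conjugate f (conj_arg x A))%:E ->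
  (forall A', G A' <= G A)%E ->
  gradient f theta = conj_arg x A ->
  (forall t, 0 < t < 1 -> forall i y, Y i y ->
    dot y (block (A + t *: B) i) <= s i + t * c i) ->
  0 <= \sum_i (c i - dot (block B i) ((x i)^T *m theta)).
Proof.
move=> GA maxA gtheta sc.
have [C smooth] :=
  real_conjugate_smooth f_diff hN mu_gt0 f_sc (conj_arg x B) gtheta.
have n0 : 0 < n%:R^-1 :> R by rewrite invr_gt0 ltr0n.
rewrite -(pmulr_rge0 _ n0) sumrB mulrBr.
have := dot_conj_arg B theta; set D := _ * _ => dotB.
apply: (@ge0_first_order _ _ C) => t t01.
have /le_trans/(_ (maxA _)) := dual_objective_ge phiE (sc t t01).
rewrite GA lee_fin conj_argD_scale big_split/= -mulr_sumr.
have /andP[_] := smooth t; rewrite dotB mulrDr; lra.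
Qed.

(** The point [theta] where the conjugate at [conj_arg x A] is attained does it.
It is feasible because moving one block of [A] along a separating normal cannot
increase the objective; its value is at most [G A] because shrinking [A] cannot
either. *)
Lemma strong_duality A :
  (forall i, closed (Y i)) -> (forall i, convex_set (Y i)) ->
  feasible x Y !=set0 -> (forall A', G A' <= G A)%E ->
  exists2 theta, feasible x Y theta & ((f theta)%:E <= G A)%E.
Proof.
move=> cY vY [theta0 feas0] maxA.
have [theta gtheta] := gradient_surj f_diff hN mu_gt0 f_sc (conj_arg x A).
(* At 0 the support functions are at most 0, hence G 0 is larger than -oo. *)
have GA_gtNy : (-oo < G A)%E.
  apply: lt_le_trans (maxA 0).
  have h i y : Y i y -> dot y (block (0 : 'M[R]_(n, k)) i) <= 0.
    by rewrite /block row0 trmx0 dot0r.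
  exact: lt_le_trans (ltNyr _) (dual_objective_ge phiE h).
have [s [ys GA]] := dual_objectiveE phiE feas0 GA_gtNy.
have feas : feasible x Y theta.
  move=> i; apply: contrapT => nYi.
  have [a [c [ya]]] := separation (cY i) (vY i) (ex_intro _ _ (feas0 i)) nYi.
  apply/negP; rewrite -leNgt.
  pose B : 'M[R]_(n, k) := \matrix_(j, l) if j == i then a l ord0 else 0.
  have BE j : block B j = if j == i then a else 0.
    by apply/matrixP => l l'; rewrite !mxE (ord1 l'); case: eqP; rewrite ?mxE.
  have := @dual_first_order A B s (fun j => if j == i then c else 0) theta
    GA maxA gtheta.
  rewrite (bigD1 i)//= big1 => [|j /negbTE ji]; last first.
    by rewrite BE ji dot0l subrr.
  rewrite BE eqxx addr0 subr_ge0 dotC; apply=> t /andP[t0 _] j y Yy.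
  rewrite blockD_scale BE dotDr dotZr lerD ?ys// ler_pM2l//.
  by case: eqP Yy => [->|_ _]; [exact: ya | rewrite dot0r].
exists theta => //.
(* In the direction - A the support functions scale by 1 - t exactly. *)
have := @dual_first_order A (- A) s (fun i => - s i) theta GA maxA gtheta.
rewrite (eq_bigr (fun i => - (s i - dot (block A i) ((x i)^T *m theta)))).
  rewrite sumrN sumrB oppr_ge0 subr_le0 => h.
  rewrite GA lee_fin (real_conjugateE f_diff mu_gt0 f_sc gtheta) dot_conj_arg.
  suff : n%:R^-1 * \sum_i s i <= n%:R^-1 *
    \sum_i dot (block A i) ((x i)^T *m theta) by lra.
  rewrite ler_wpM2l ?invr_ge0//; apply: h => t /andP[t0 t1] i y Yy.
  rewrite blockD_scale dotDr dotZr.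
  have -> : block (- A) i = - block A i by apply/matrixP => a b; rewrite !mxE.
  have : (1 - t) * dot y (block A i) <= (1 - t) * s i.
    by rewrite ler_wpM2l ?ys//; lra.
  by rewrite dotNr; lra.
move=> i _.
have -> : block (- A) i = - block A i by apply/matrixP => a b; rewrite !mxE.
by rewrite dotNl; ring.
Qed.

End StrongDuality.
End Duality.

Theorem proposition1 (R : realType) (n d k : nat) (hn : (0 < n)%N)
    (psi : 'cV[R]_d -> \bar R)
    (psi_gtNy : forall theta, (-oo < psi theta)%E)
    (psi_diff : forall theta, edifferentiable psi theta)
    (N : 'cV[R]_d -> R) (hN : is_norm N)
    (mu : R) (mu_gt0 : 0 < mu)
    (psi_sc : strongly_convex mu N psi)
    (x : 'I_n -> 'M[R]_(d, k))
    (Y : 'I_n -> set 'cV[R]_k)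
    (Y_closed : forall i, closed (Y i))
    (Y_convex : forall i, convex_set (Y i))
    (hfeas : exists theta, (psi theta < +oo)%E /\ feasible x Y theta)
    (thetastar : 'cV[R]_d)
    (hthetastar : is_argmin (feasible x Y) psi thetastar)
    (alphastar : 'M[R]_(n, k))
    (halphastar : forall alpha : 'M[R]_(n, k),
      (dual_objective psi x Y alpha <= dual_objective psi x Y alphastar)%E)
    (alpha : 'M[R]_(n, k)) :
  (bregman psi thetastar (primal_point psi x alpha)
     <= gap psi x Y alphastar alpha)%E.
Proof.
pose f := fine \o psi.
have psiE : psi = EFin \o f.
  apply/funext => u /=; rewrite fineK//.
  by have [/nbhs_singleton] := psi_diff u.
have f_diff u : differentiable f u by have [] := psi_diff u.
move: psi_sc hthetastar halphastar; rewrite /primal_point /gap psiE => {}psi_sc.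
move=> [feas_star min_star] max_star.
have phiE := fin_fenchel_conjugate f_diff hN mu_gt0 psi_sc.
have [theta feas le_G] := strong_duality hn f_diff hN mu_gt0 psi_sc
  Y_closed Y_convex (ex_intro _ _ feas_star) max_star.
have [eta geta] := gradient_surj f_diff hN mu_gt0 psi_sc (conj_arg x alpha).
rewrite (egradient_conjugate f_diff hN mu_gt0 psi_sc geta) /bregman.
have -> : egradient (EFin \o f) eta = conj_arg x alpha by rewrite -geta.
have weak := dual_objective_le x phiE alpha feas_star.
apply: (le_trans _ (leeB (le_trans (min_star _ feas) le_G) weak)).
(* Both sides are now real and equal: this is the Fenchel-Young identity. *)
rewrite /= -!EFinB lee_fin (real_conjugateE f_diff mu_gt0 psi_sc geta).
rewrite dotDr dotNr dot_conj_arg.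
under eq_bigr do rewrite dotC.
lra.
Qed.
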